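(* Let $x\in\mathcal X$, and let $T_1(x),\dots,T_n(x)$ be the $n$ realizations of $\mathbb T(x)$ with associated probabilities $p_1,\dots,p_n$. Let $\gamma$ be a probability level, and let $\alpha^*$ be the output of the threshold algorithm (described in the context) run on input $\gamma$, $\{p_i\}_{i=1}^n$ and $b\in\mathbb N$. If $\alpha$ satisfies $\gamma>\alpha\ge\alpha^*$, then $$\mathbb E_{\alpha-\gamma}[\mathbb T(x)]=\mathrm{VaR}_\gamma\mathbb T(x).$$
   Context: Let $\mathcal X\subseteq\mathbb R^k$ be nonempty and let $Y$ be a discrete random vector in $\mathbb R^m$ on a probability space with probability measure $\mathbb P$, having $n$ distinct realizations (atoms) $y_1,\dots,y_n$ with probabilities $p_1,\dots,p_n$ ($p_i>0$, $\sum_i p_i=1$). Let $f:\mathcal X\times\mathbb R^m\to\mathbb R$ be such that for each fixed realization $y$ of $Y$, $f(x,y)$ is linear in $x$. For $x\in\mathcal X$ put $\mathbb T(x)=f(x,Y)$ and $T_i(x)=f(x,y_i)$, so $\mathbb T(x)$ has realizations $T_i(x)$ with associated probabilities $p_i$. Let $F(t)=\mathbb P(\mathbb T(x)\le t)$ and $F^{-1}(p)=\inf\{t: F(t)\ge p\}$. Probability levels are numbers in $[0,1]$. Value-at-risk: $\mathrm{VaR}_p\mathbb T(x)=\inf\{\eta\in\mathbb R:\mathbb P(\mathbb T(x)\le\eta)\ge p\}=F^{-1}(p)$. For $0\le\alpha<1$, $\mathbb E_{\alpha-1}[\mathbb T(x)]=\frac1{1-\alpha}\max\{\sum_{i=1}^n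 T_i(x)w_ip_i : w\in[0,1]^n,\ \sum_{i=1}^n w_ip_i=1-\alpha\}$. For $0\le\alpha<\gamma\le1$, the $\alpha-\gamma$ expectation is $\mathbb E_{\alpha-\gamma}[\mathbb T(x)]=\frac1{\gamma-\alpha}\big((1-\alpha)\mathbb E_{\alpha-1}[\mathbb T(x)]-(1-\gamma)\mathbb E_{\gamma-1}[\mathbb T(x)]\big)$ (the last term is $0$ if $\gamma=1$); equivalently it is $\frac1{\gamma-\alpha}\int_\alpha^\gamma F^{-1}(p)\,dp$. Threshold algorithm. Input: $\gamma$, $\{p_i\}_{i=1}^n$, a positive integer $b$. For a real $a$ let $O(a)=\min\{O: O\ge\sum_{i=1}^n\eta_ip_i\ge a,\ \eta\in\{0,1\}^n\}$. Start with $\alpha_0=0$, $O^*=O(\alpha_0)$ and $k=1$. While $O^*<\gamma$: set $\alpha_k=\alpha_{k-1}+\frac{\gamma-\alpha_{k-1}}{b}$, set $O^*=O(\alpha_k)$, and increase $k$ by one. When the loop stops, return as $\alpha^*$ the last computed value of $\alpha_k$. *)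

(* Defs.v *)
From HB Require Import structures.
From mathcomp Require Import all_boot all_order all_algebra.
From mathcomp Require Import all_classical all_reals all_analysis.
From mathcomp Require Import lra.

Set Implicit Arguments.
Unset Strict Implicit.
Unset Printing Implicit Defensive.

Import Order.TTheory GRing.Theory Num.Theory.
Import numFieldNormedType.Exports.

Local Open Scope classical_set_scope.
Local Open Scope ring_scope.

Section Vectors.
Context {R : realType}.

Lemma measurable_tuple_set1 (m : nat) (v : m.-tuple R) :
  measurable [set v].
Proof.
have -> : [set v] =
    \bigcap_(i in [set: 'I_m]) ((@tnth m R ^~ i) @^-1` [set tnth v i]).
  apply/seteqP; split => [u -> i _ //|u uv].
  by apply: eq_from_tnth => i; exact: uv.
apply: fin_bigcap_measurable => // i _.
rewrite -[X in measurable X]setTI; apply: measurable_tnth => //.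
Qed.

End Vectors.

Section RandomVariables.
Context {d : measure_display} {Omega : measurableType d} {R : realType}
  (P : probability Omega R) {m : nat}.

(* [g] need not be measurable: [Y] has a countable range. *)
Definition img_dRV (Y : {dRV P >-> m.-tuple R}) (g : m.-tuple R -> R)
  : Omega -> R := fun w => g (Y w).

Lemma measurable_img_dRV (Y : {dRV P >-> m.-tuple R}) (g : m.-tuple R -> R) :
  measurable_fun setT (img_dRV Y g).
Proof.
move=> _ B mB; rewrite setTI.
have -> : img_dRV Y g @^-1` B =
    \bigcup_(k in dRV_dom Y `&` [set k | B (g (dRV_enum Y k))])
      (Y @^-1` [set dRV_enum Y k]).
  apply/seteqP; split => [w /= Bw|w [k [_ Bk] /= Yw]]; last first.
    by rewrite /= /img_dRV Yw.
  have [k Dk Yk] : exists2 k, dRV_dom Y k & dRV_enum Y k = Y w.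
    have [k Dk Yk] : (dRV_enum Y @` dRV_dom Y) (Y w).
      by apply: surj; exists w.
    by exists k.
  by exists k => //=; split => //=; rewrite Yk.
apply: bigcup_measurable => k _.
by rewrite -[X in measurable X]setTI; apply: measurable_funPT => //;
  exact: measurable_tuple_set1.
Qed.

HB.instance Definition _ Y g :=
  isMeasurableFun.Build _ _ _ _ (img_dRV Y g) (measurable_img_dRV Y g).

Lemma countable_range_img_dRV Y g : countable (range (img_dRV Y g)).
Proof.
rewrite (_ : range _ = g @` range Y); last by rewrite image_comp.
apply: (sub_countable (card_image_le _ _)); exact: countable_range.
Qed.

HB.instance Definition _ Y g :=
  MeasurableFun_isDiscrete.Build _ _ _ _ (img_dRV Y g)
    (countable_range_img_dRV Y g).

(* 𝕋(x) = f(x, Y), as a (discrete) real random variable. *)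
Definition RVat (k : nat) (f : 'rV[R]_k -> m.-tuple R -> R)
  (Y : {dRV P >-> m.-tuple R}) (x : 'rV[R]_k) : {dRV P >-> R} :=
  img_dRV Y (f x).

(* An extended real, so that the infimum is the true one also at p = 0. *)
Definition VaR (p : R) (Z : {RV P >-> R}) : \bar R :=
  ereal_inf [set eta%:E | eta in [set eta : R | (p%:E <= cdf Z eta)%E]].

End RandomVariables.
Arguments img_dRV {d Omega R P m}.
Arguments RVat {d Omega R P m k}.
Arguments VaR {d Omega R} P p Z.

Section Expectations.
Context {R : realType} {n : nat}.
Implicit Types p t w : 'I_n -> R.

Definition tail_weights p (alpha : R) : set ('I_n -> R) :=
  [set w | (forall i, 0 <= w i <= 1) /\ \sum_(i < n) w i * p i = 1 - alpha].

Definition tail_values p t (alpha : R) : set R :=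
  [set \sum_(i < n) t i * w i * p i | w in tail_weights p alpha].

(* The supremum is a maximum: see [tail_values_max]. *)
Definition tail_expectation p t (alpha : R) : R :=
  (1 - alpha)^-1 * sup (tail_values p t alpha).

(* For gamma = 1 the last term vanishes because of its factor 1 - gamma. *)
Definition range_expectation p t (alpha gamma : R) : R :=
  (gamma - alpha)^-1 *
    ((1 - alpha) * tail_expectation p t alpha
     - (1 - gamma) * tail_expectation p t gamma).

Lemma tail_values_max p t alpha : (forall i, 0 < p i) ->
  \sum_(i < n) p i = 1 -> 0 <= alpha < 1 ->
  tail_values p t alpha (sup (tail_values p t alpha)) /\
  ubound (tail_values p t alpha) (sup (tail_values p t alpha)).
Proof.
move=> p0 p1 /andP[a0 a1].
pose A := [set v : 'rV[R]_n | tail_weights p alpha (v ord0)].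
pose h := fun v : 'rV[R]_n => \sum_(i < n) t i * v ord0 i * p i.
have coordc (i : 'I_n) : continuous (fun v : 'rV[R]_n => v ord0 i).
  exact: coord_continuous.
have gc : continuous (fun v : 'rV[R]_n => \sum_(i < n) v ord0 i * p i).
  apply: continuous_big => [|i _ v]; first exact: add_continuous.
  exact: (cvgMr_tmp (coordc i v)).
have hc : continuous h.
  apply: continuous_big => [|i _ v]; first exact: add_continuous.
  exact: (cvgMr_tmp (cvgMl_tmp (coordc i v))).
have A0 : A !=set0.
  exists (\row_i (1 - alpha)); split => [i|].
    by rewrite mxE; apply/andP; split; lra.
  under eq_bigr do rewrite mxE.
  by rewrite -mulr_sumr p1 mulr1.
have cA : compact A.
  apply: (@subclosed_compact _ _
      [set v : 'rV[R]_n | forall i, `[0, 1]%classic (v ord0 i)]).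
  - have -> : A = (\bigcap_i [set v : 'rV[R]_n | `[0, 1]%classic (v ord0 i)])
        `&` ((fun v : 'rV[R]_n => \sum_(i < n) v ord0 i * p i)
             @^-1` [set 1 - alpha]).
      apply/seteqP; split => v /=.
        by move=> [vi vs]; split => // i _ /=; rewrite in_itv/=; exact: vi.
      by move=> [vi vs]; split => // i; have := vi i I; rewrite /= in_itv.
    apply: closedI.
      apply: closed_bigI => i _.
      apply: (@preimage_closed _ _ (fun v : 'rV[R]_n => v ord0 i)) => //.
        exact: interval_closed.
    by apply: (@preimage_closed _ _ _ [set 1 - alpha]) => //; exact: closed_eq.
  - apply: (@rV_compact R n (fun=> `[0, 1]%classic)) => _.
    exact: segment_compact.
  - by move=> v [vi _] i; rewrite /= in_itv/=; exact: vi.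
have [c] := compact_EVT_max A0 cA (continuous_subspaceT hc).
rewrite inE => Ac hmax.
have tub : ubound (tail_values p t alpha) (h c).
  move=> _ [w [w01 ws] <-].
  have Aw : A (\row_i w i).
    split => [i|]; first by rewrite mxE; exact: w01.
    by rewrite -ws; apply: eq_bigr => i _; rewrite mxE.
  rewrite (_ : \sum_(i < n) _ = h (\row_i w i)); last first.
    by apply: eq_bigr => i _; rewrite mxE.
  by apply: hmax; rewrite inE.
have tin : tail_values p t alpha (h c) by exists (c ord0).
have -> : sup (tail_values p t alpha) = h c.
  apply/eqP; rewrite eq_le; apply/andP; split.
    by apply: ge_sup => //; exists (h c).
  by apply: ub_le_sup => //; exists (h c).
by [].
Qed.

End Expectations.

Section ThresholdAlgorithm.
Context {R : realType} {n : nat}.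
Implicit Types (p : 'I_n -> R) (gamma a : R).

Definition upper_levels p (a : R) : set R :=
  [set O | exists eta : {ffun 'I_n -> bool},
     a <= \sum_(i < n) (eta i)%:R * p i <= O].

(* The infimum is a minimum: see [next_level_min]. *)
Definition next_level p (a : R) : R := inf (upper_levels p a).

(* [threshold_loop gamma p b a astar]: the while loop entered with current
   value [a] of alpha_k (and O* = O(a)) stops and returns [astar]. *)
Inductive threshold_loop (gamma : R) p (b : nat) : R -> R -> Prop :=
| threshold_stop a :
    gamma <= next_level p a -> threshold_loop gamma p b a a
| threshold_step a astar :
    next_level p a < gamma ->
    threshold_loop gamma p b (a + (gamma - a) / b%:R) astar ->
    threshold_loop gamma p b a astar.

Definition threshold_output (gamma : R) p (b : nat) (astar : R) : Prop :=
  threshold_loop gamma p b 0 astar.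

Lemma next_level_attained p a : a <= \sum_(i < n) p i ->
  exists2 eta : {ffun 'I_n -> bool},
    a <= \sum_(i < n) (eta i)%:R * p i &
    next_level p a = \sum_(i < n) (eta i)%:R * p i.
Proof.
move=> ap; pose s (eta : {ffun 'I_n -> bool}) := \sum_(i < n) (eta i)%:R * p i.
pose e1 : {ffun 'I_n -> bool} := [ffun => true].
have ae1 : a <= s e1.
  rewrite (le_trans ap)// le_eqVlt; apply/orP; left; apply/eqP.
  by apply: eq_bigr => i _; rewrite ffunE mul1r.
case: (@Order.TotalTheory.arg_minP _ _ _ e1 (fun e => a <= s e) s ae1) => e ae emin.
have lbe : lbound (upper_levels p a) (s e).
  by move=> O [eta /andP[aeta etaO]]; exact: le_trans (emin _ aeta) etaO.
have ine : upper_levels p a (s e) by exists e; rewrite ae /=.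
exists e => //; apply/eqP; rewrite eq_le; apply/andP; split.
  by apply: ge_inf => //; exists (s e).
by apply: lb_le_inf => //; exists (s e).
Qed.

Lemma next_level_min p a : a <= \sum_(i < n) p i ->
  upper_levels p a (next_level p a) /\
  lbound (upper_levels p a) (next_level p a).
Proof.
move=> /next_level_attained[e ae Oe]; split.
  by exists e; rewrite Oe ae /=.
by apply: ge_inf; exists a => O [eta /andP[+ +]]; exact: le_trans.
Qed.

Lemma threshold_output_exists gamma p b : (forall i, 0 < p i) ->
  \sum_(i < n) p i = 1 -> 0 <= gamma <= 1 -> (0 < b)%N ->
  exists astar, threshold_output gamma p b astar.
Proof.
move=> p0 p1 /andP[g0 g1] b0.
pose s (eta : {ffun 'I_n -> bool}) := \sum_(i < n) (eta i)%:R * p i.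
pose delta : R := \big[Num.min/1]_(eta | s eta < gamma) (gamma - s eta).
have d0 : 0 < delta by apply: lt_bigmin => // eta; rewrite subr_gt0.
have near a : a <= gamma -> gamma - a < delta -> gamma <= next_level p a.
  move=> ag gad; rewrite leNgt; apply/negP.
  have [|e ae ->] := @next_level_attained p a; first by rewrite p1; lra.
  move=> eg; have : delta <= gamma - s e by exact: bigmin_le_cond.
  by move: ae; rewrite -/(s e) => ae; lra.
pose c : R := 1 - b%:R^-1.
have b1 : 0 < (b%:R^-1 : R) <= 1.
  by rewrite invr_gt0 ltr0n b0 /= invf_le1 ?ltr0n// ler1n.
have c01 : 0 <= c < 1 by rewrite /c; lra.
have [N cN] : exists N, gamma * c ^+ N < delta.
  have /cvgr_lt : geometric gamma c @ \oo --> 0.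
    by apply: cvg_geometric; rewrite ger0_norm; lra.
  by move=> /(_ _ d0)[N _ /(_ N)]/= => /(_ (leqnn N)); exists N.
suff loop M a : a <= gamma -> (gamma - a) * c ^+ M < delta ->
    exists astar, threshold_loop gamma p b a astar.
  by apply: (loop N) => //; rewrite subr0.
elim: M a => [|M IH] a ag gad.
  by exists a; apply/threshold_stop/near => //; rewrite expr0 mulr1 in gad.
have [ga|ga] := leP gamma (next_level p a); first by exists a; left.
have E : gamma - (a + (gamma - a) / b%:R) = (gamma - a) * c by rewrite /c; lra.
have [||astar] := IH (a + (gamma - a) / b%:R).
- by rewrite -subr_ge0 E mulr_ge0; lra.
- by rewrite E -mulrA -exprS.
by exists astar; right.
Qed.

Lemma threshold_output_unique gamma p b a1 a2 :
  threshold_output gamma p b a1 -> threshold_output gamma p b a2 -> a1 = a2.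
Proof.
rewrite /threshold_output => h; elim: h a2 => [a ga|a a' ag _ IH] a2 h.
  inversion h; subst => //.
  by move: H; rewrite ltNge ga.
inversion h; subst; last exact: IH.
by move: ag; rewrite ltNge H.
Qed.

End ThresholdAlgorithm.

(* Main.v *)
Require Import Defs.
From mathcomp Require Import all_boot all_order all_algebra.
From mathcomp Require Import all_classical all_reals all_analysis.
From mathcomp Require Import lra.

Set Implicit Arguments.
Unset Strict Implicit.
Unset Printing Implicit Defensive.

Import Order.TTheory GRing.Theory Num.Theory.

Local Open Scope classical_set_scope.
Local Open Scope ring_scope.

(** Write [t i] for the realizations [f x (y i)] and let [q] be the value at
    risk at level [gamma], which is one of the [t i].

    When the threshold loop exits with [astar], the least probability of a set
    of atoms that is at least [astar] is already at least [gamma].  Hence no set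
    of atoms whatsoever has probability in [[astar, gamma)], nor in
    [[alpha, gamma)] ([threshold_loop_gap]).  The set of atoms with [t i < q]
    has probability less than [gamma], since [q] is the [gamma]-quantile
    ([quantile_exists]); by the gap it has probability less than [alpha].  So
    the distribution function jumps over all of [[alpha, gamma]] at [q]: [q] is
    a quantile both at level [alpha] and at level [gamma].

    If [q] is a quantile at level [beta], the unnormalized tail expectation is
      [(1 - beta) * tail_expectation p t beta
         = q * (1 - beta) + \sum_i Num.max (t i - q) 0 * p i]
    ([tail_expectation_quantile]).  The sum does not depend on [beta], so it
    cancels in the difference of the tail expectations at [alpha] and [gamma],
    which is therefore [q * (gamma - alpha)]. *)

Lemma prob_atoms_le (R : realType) (m n : nat) (d : measure_display)
  (Omega : measurableType d) (P : probability Omega R)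
  (Y : {dRV P >-> m.-tuple R}) (y : 'I_n -> m.-tuple R) (p : 'I_n -> R)
  (A : pred 'I_n) (E : set Omega) :
  injective y -> (forall i, P (Y @^-1` [set y i]) = (p i)%:E) ->
  measurable E -> (forall i, A i -> Y @^-1` [set y i] `<=` E) ->
  ((\sum_(i < n | A i) p i)%:E <= P E)%E.
Proof.
move=> y_inj Y_law mE AE; rewrite -sumEFin.
have -> : (\sum_(i < n | A i) (p i)%:E =
    \sum_(i < n | A i) P (Y @^-1` [set y i]))%E.
  by apply: eq_bigr => i _; rewrite Y_law.
have mY i : measurable (Y @^-1` [set y i]).
  rewrite -[X in measurable X]setTI; apply: measurable_funPT => //.
  exact: measurable_tuple_set1.
rewrite -measure_bigsetU_ord_cond//.
  apply: le_measure; rewrite ?inE//; first exact: bigsetU_measurable.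
  by elim/big_ind: _ => // U V UE VE; rewrite subUset; split.
by move=> i j _ _ [w [/= -> /y_inj]].
Qed.

(** The atoms carry total mass 1, so the lower bound of [prob_atoms_le] for the
    event and the one for its complement are both equalities.  In this way
    values of [Y] outside the atoms never have to be considered. *)
Lemma cdf_RVat (R : realType) (k m n : nat) (d : measure_display)
  (Omega : measurableType d) (P : probability Omega R)
  (Y : {dRV P >-> m.-tuple R}) (y : 'I_n -> m.-tuple R) (p : 'I_n -> R)
  (f : 'rV[R]_k -> m.-tuple R -> R) (x : 'rV[R]_k) (eta : R) :
  injective y -> (forall i, P (Y @^-1` [set y i]) = (p i)%:E) ->
  \sum_(i < n) p i = 1 ->
  cdf (RVat f Y x : {RV P >-> R}) eta = (\sum_(i < n | f x (y i) <= eta) p i)%:E.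
Proof.
move=> y_inj Y_law p1; rewrite /cdf /distribution /pushforward.
set E := _ @^-1` _.
have mE : measurable E.
  by rewrite -[E]setTI; apply: measurable_funPT => //; exact: measurable_itv.
have lo : ((\sum_(i < n | f x (y i) <= eta) p i)%:E <= P E)%E.
  apply: (prob_atoms_le y_inj Y_law) => // i fi w /= Yw.
  by rewrite /E /= /img_dRV in_itv /= Yw.
have hi : ((\sum_(i < n | ~~ (f x (y i) <= eta)) p i)%:E <= P (~` E))%E.
  apply: (prob_atoms_le y_inj Y_law); first exact: measurableC.
  move=> i /negP fi w /= Yw.
  by rewrite /E /= /img_dRV in_itv /= Yw.
move: lo hi; rewrite probability_setC// -(fineK (fin_num_measure P E mE)).
rewrite !lee_fin => lo hi; congr EFin; apply/eqP; rewrite eq_le lo andbT.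
by move: p1; rewrite (bigID (fun i => f x (y i) <= eta)) /=; lra.
Qed.

(** In any set of atoms of mass at least [gamma], the largest value has
    distribution function at least [gamma]; the quantile is the least value with
    this property.  Quantifying over all sets [A] gives both facts needed about
    the quantile: with [A] the atoms of value at most [eta], that it is the
    infimum defining the value at risk; with [A] the atoms of value less than
    [t j], that these have mass less than [gamma]. *)
Lemma quantile_exists (R : realType) (n : nat) (p t : 'I_n -> R) (gamma : R) :
  (forall i, 0 < p i) -> \sum_(i < n) p i = 1 -> 0 < gamma <= 1 ->
  exists j, gamma <= \sum_(i < n | t i <= t j) p i /\
    forall A : pred 'I_n, gamma <= \sum_(i < n | A i) p i ->
      exists2 i, A i & t j <= t i.
Proof.
move=> p0 p1 /andP[g0 g1].
have top (A : pred 'I_n) : gamma <= \sum_(i < n | A i) p i ->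
    exists2 i, A i & gamma <= \sum_(l < n | t l <= t i) p l.
  move=> gA; have [i0 Ai0|A0] := pickP A; last first.
    by move: gA; rewrite big_pred0// leNgt g0.
  case: (@Order.TotalTheory.arg_maxP _ _ _ i0 A t Ai0) => i Ai imax.
  exists i => //; apply: le_trans gA _.
  rewrite [leLHS]big_mkcond [leRHS]big_mkcond; apply: ler_sum => l _.
  case: ifP => [/imax tl|_]; first by rewrite [t l <= t i]tl.
  by case: ifP => // _; exact: ltW.
have [|i0 _ gi0] := top predT; first by rewrite p1.
case: (@Order.TotalTheory.arg_minP _ _ _ i0
  (fun i => gamma <= \sum_(l < n | t l <= t i) p l) t gi0) => j gj jmin.
by exists j; split => // A /top[i Ai gi]; exists i => //; exact: jmin.
Qed.

(** The right-hand side is the Rockafellar-Uryasev formula at the quantile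
    [t j].  For admissible weights [w],
      [\sum_i t i * w i * p i
         = t j * (1 - beta) + \sum_i (t i - t j) * w i * p i],
    and the last sum is at most the sum of the positive parts, with equality
    when [w] is 1 above [t j] and 0 below it.  The quantile condition says
    exactly that some weight in [[0, 1]] at [t j] itself makes this [w]
    admissible. *)
Lemma tail_expectation_quantile (R : realType) (n : nat) (p t : 'I_n -> R)
  (beta : R) (j : 'I_n) :
  (forall i, 0 < p i) -> \sum_(i < n) p i = 1 -> beta <= 1 ->
  \sum_(i < n | t i < t j) p i <= beta <= \sum_(i < n | t i <= t j) p i ->
  (1 - beta) * tail_expectation p t beta =
  t j * (1 - beta) + \sum_(i < n) Num.max (t i - t j) 0 * p i.
Proof.
move=> p0 p1 b1 /andP[bl bu].
set S := (X in _ = X).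
pose e := \sum_(i < n | t i == t j) p i.
have e0 : 0 < e.
  rewrite /e (bigD1 j)//= ltr_pwDl// sumr_ge0// => i _; exact: ltW.
have split_le : \sum_(i < n | t i <= t j) p i = \sum_(i < n | t i < t j) p i + e.
  rewrite (bigID (fun i => t i < t j)) /=; congr (_ + _); apply: eq_bigl => i.
    by rewrite lt_neqAle andbC -andbA andbb.
  by rewrite -leNgt eq_le.
have total : \sum_(i < n | t i <= t j) p i + \sum_(i < n | t j < t i) p i = 1.
  rewrite -p1 [RHS](bigID (fun i => t i <= t j)) /=; congr (_ + _).
  by apply: eq_bigl => i; rewrite -ltNge.
(* The mass [1 - beta] minus the mass above [t j], spread over the atoms of
   value [t j], whose mass is [e]. *)
pose theta := (\sum_(i < n | t i <= t j) p i - beta) / e.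
have theta01 : 0 <= theta <= 1.
  by rewrite /theta divr_ge0 ?ler_pdivrMr//=; lra.
pose w i : R := if t j < t i then 1 else if t i == t j then theta else 0.
have shift v : \sum_(i < n) v i * p i = 1 - beta ->
    \sum_(i < n) t i * v i * p i =
    t j * (1 - beta) + \sum_(i < n) (t i - t j) * v i * p i.
  by move=> <-; rewrite mulr_sumr -big_split; apply: eq_bigr => i _ /=; lra.
have w_tail : tail_weights p beta w.
  split => [i|].
    by rewrite /w; case: ifP => _; [lra|case: ifP => _; lra].
  have -> : \sum_(i < n) w i * p i =
      \sum_(i < n | t j < t i) p i + theta * e.
    rewrite /e mulr_sumr [X in X + _]big_mkcond [X in _ + X]big_mkcond -big_split.
    apply: eq_bigr => i _ /=; rewrite /w; case: ltgtP => _ /=; lra.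
  by rewrite /theta divfK ?gt_eqF//; lra.
have S_in : tail_values p t beta S.
  exists w => //; rewrite shift ?w_tail.2// /S; congr (_ + _).
  apply: eq_bigr => i _; congr (_ * _); rewrite /w.
  by case: (ltgtP (t j) (t i)) => h; [rewrite max_l|rewrite max_r|rewrite h max_r]; lra.
have [b1'|b1'] := eqVneq beta 1.
  (* The factor [1 - beta] does not cancel here, but admissible weights have
     [w i * p i = 0] for all [i], so [S], being attained, vanishes too. *)
  rewrite b1' subrr mul0r; case: S_in => v [v01]; rewrite b1' subrr => v0 <-.
  rewrite big1// => i _; rewrite -mulrA.
  have /eqP := v0; rewrite psumr_eq0 => [/allP/(_ i)|l _].
    by rewrite mem_index_enum => /(_ isT)/eqP ->; rewrite mulr0.
  by rewrite mulr_ge0 ?(ltW (p0 l))//; case/andP: (v01 l).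
have bne : 1 - beta != 0 by rewrite subr_eq0 eq_sym.
rewrite /tail_expectation mulVKf//.
have S_ub : ubound (tail_values p t beta) S.
  move=> _ [v [v01 vs] <-]; rewrite shift// lerD2l; apply: ler_sum => i _.
  rewrite ler_pM2r//; have /andP[v0 v1] := v01 i.
  have [h|h] := leP (t i - t j) 0; first by rewrite mulr_le0_ge0.
  by rewrite ler_piMr// ltW.
apply/eqP; rewrite eq_le; apply/andP; split.
  by apply: ge_sup => //; exists S.
by apply: ub_le_sup => //; exists S.
Qed.

(** The gap comes from the exit test alone: a set of atoms of mass at least
    [astar] is a competitor in the minimum defining [next_level p astar].  Each
    step moves [a] towards [gamma] without passing it, which gives
    [0 <= astar] and thereby [0 < gamma] when some [alpha] lies in
    [[astar, gamma)]. *)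
Lemma threshold_loop_gap (R : realType) (n : nat) (p : 'I_n -> R) (gamma : R)
  (b : nat) (a astar : R) :
  (0 < b)%N -> threshold_loop gamma p b a astar -> 0 <= a <= gamma ->
  0 <= astar /\
  forall A : pred 'I_n, astar <= \sum_(i < n | A i) p i ->
    gamma <= \sum_(i < n | A i) p i.
Proof.
move=> b0; elim => {a astar} [a ga|a astar _ _ IH] /andP[a0 ag].
  split => // A aA; apply: le_trans ga _; apply: ge_inf.
    by exists a => O [eta /andP[+ +]]; exact: le_trans.
  exists [ffun i => A i].
  have -> : \sum_(i < n) ([ffun i => A i] i)%:R * p i = \sum_(i < n | A i) p i.
    rewrite [RHS]big_mkcond; apply: eq_bigr => i _; rewrite ffunE.
    by case: (A i); rewrite ?mul1r ?mul0r.
  by rewrite aA /=.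
apply: IH; have b1 : (1 : R) <= b%:R by rewrite ler1n.
have step0 : 0 <= (gamma - a) / b%:R by rewrite divr_ge0 ?subr_ge0.
have : (gamma - a) / b%:R <= gamma - a.
  by rewrite ler_pdivrMr ?ler_peMr ?subr_ge0//; lra.
lra.
Qed.

Theorem proposition2 (R : realType) (k m n : nat)
  (d : measure_display) (Omega : measurableType d) (P : probability Omega R)
  (X : set 'rV[R]_k) (X_nonempty : X !=set0)
  (Y : {dRV P >-> m.-tuple R})
  (y : 'I_n -> m.-tuple R) (p : 'I_n -> R)
  (y_distinct : injective y)
  (p_gt0 : forall i, 0 < p i)
  (p_sum1 : \sum_(i < n) p i = 1)
  (Y_law : forall i, P (Y @^-1` [set y i]) = (p i)%:E)
  (f : 'rV[R]_k -> m.-tuple R -> R)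
  (f_linear : forall i, exists L : {scalar 'rV[R]_k},
     forall z, X z -> f z (y i) = L z)
  (x : 'rV[R]_k) (xX : X x)
  (gamma : R) (gamma_level : 0 <= gamma <= 1)
  (b : nat) (b_gt0 : (0 < b)%N)
  (astar : R) (astar_output : threshold_output gamma p b astar)
  (alpha : R) (alpha_range : astar <= alpha < gamma) :
  (range_expectation p (fun i => f x (y i)) alpha gamma)%:E
  = VaR P gamma (RVat f Y x).
Proof.
have [astar0 gap] := threshold_loop_gap b_gt0 astar_output
  (introT andP (conj (lexx 0) (proj1 (andP gamma_level)))).
case/andP: gamma_level => _ g1; case/andP: alpha_range => aa ag.
set t := fun i => f x (y i).
have [|j [gj jmin]] := @quantile_exists R n p t gamma p_gt0 p_sum1.
  by rewrite g1 andbT; lra.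
have lt_gamma : \sum_(i < n | t i < t j) p i < gamma.
  by rewrite ltNge; apply/negP => /jmin[i /=]; rewrite ltNge => /negP.
have lt_alpha : \sum_(i < n | t i < t j) p i < alpha.
  rewrite ltNge; apply/negP => h; move: lt_gamma; rewrite ltNge => /negP; apply.
  by apply: gap; exact: le_trans h.
have -> : VaR P gamma (RVat f Y x) = (t j)%:E.
  apply/eqP; rewrite eq_le; apply/andP; split.
    apply: ereal_inf_lbound; exists (t j) => //=.
    by rewrite (cdf_RVat _ _ _ y_distinct Y_law p_sum1) lee_fin.
  apply: le_ereal_inf_tmp => _ [eta /= + <-].
  rewrite (cdf_RVat _ _ _ y_distinct Y_law p_sum1) !lee_fin => /jmin[i /= ti].
  by move=> /le_trans; apply.
congr EFin; rewrite /range_expectation.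
rewrite !(@tail_expectation_quantile _ _ _ _ _ j)//; try lra.
rewrite opprD addrACA subrr addr0 -mulrBr mulrC.
by rewrite (_ : 1 - alpha - (1 - gamma) = gamma - alpha) ?mulfK//; lra.
Qed.
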